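(* Let $(M,g)$ be a semi-Riemannian manifold of dimension $n\ge3$ satisfying $P\cdot\mathcal P=L\,Q(S,\mathcal P)$ for some $L\in C^\infty(M)$. Then: (i) $(L-1)(n-1)E=-(1+L(n-1))\,\kappa S+(1+L(n^2-1))\,S^2$. (ii) $n^2S^2-2n\kappa S+\kappa^2g=0$ and $\kappa^{(2)}=\frac{\kappa^2}{n}$ if $L+\frac{1}{n-1}\ne0$. (iii) $\frac{n}{n-1}(P\cdot\mathcal S)=\left(L-\frac{1}{(n-1)^2}\right)Q(S,\mathcal S)$ holds if $L+\frac{1}{n-1}\ne0$ and $$R(Y,X_1,X_2,\mathcal SX)+R(Y,X_2,X_1,\mathcal SX)-R(X,X_1,X_2,\mathcal SY)-R(X,X_2,X_1,\mathcal SY)=0$$ for all vector fields $X_1,X_2,X,Y$. (iv) $S\wedge S=g\wedge S^2$.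
   Context: $(M,g)$ is a connected smooth semi-Riemannian manifold of dimension $n\ge 3$; $R$ is the $(0,4)$ Riemann curvature tensor, with the sign convention that the Ricci tensor $S(X_2,X_3)$ is the $g$-trace of $R(X_1,X_2,X_3,X_4)$ over $X_1,X_4$; $\kappa$ is the scalar curvature; $\mathcal S$ is the Ricci operator, $g(\mathcal SX,Y)=S(X,Y)$, $S^2(X,Y)=g(\mathcal S^2X,Y)$, $\kappa^{(2)}=\mathrm{trace}(\mathcal S^2)$. $E(X,Y)$ is the $(0,2)$-tensor obtained by contracting $R(X_1,X,Y,\mathcal SX_2)$ over $X_1,X_2$. Projective curvature tensor: $P(X_1,X_2,X_3,X_4)=R(X_1,X_2,X_3,X_4)-\frac{1}{n-1}\left[S(X_2,X_3)g(X_1,X_4)-S(X_1,X_3)g(X_2,X_4)\right]$; $\mathcal P$ is its $(1,3)$-version, $g(\mathcal P(X,Y)X_1,X_2)=P(X,Y,X_1,X_2)$. An endomorphism $\mathscr L$ of vector fields acts on a $(1,k-1)$-tensor $\mathcal H$ by $(\mathscr L\mathcal H)(X_1,\dots,X_{k-1})=\mathscr L(\mathcal H(X_1,\dots,X_{k-1}))-\sum_i\mathcal H(X_1,\dots,\mathscr LX_i,\dots,X_{k-1})$. $P\cdot\mathcal H$ is obtained with $\mathscr L=\mathcal P(X,Y)$ ($X,Y$ placed as last arguments); for a symmetric $(0,2)$-tensor $A$, $Q(A,\mathcal H)$ is obtained with $\mathscr L=X\wedge_AY$, $(X\wedge_AY)Z=A(Y,Z)X-A(X,Z)Y$. Kulkarni–Nomizu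 product: $(A\wedge F)(X_1,X_2,X_3,X_4)=A(X_1,X_4)F(X_2,X_3)+A(X_2,X_3)F(X_1,X_4)-A(X_1,X_3)F(X_2,X_4)-A(X_2,X_4)F(X_1,X_3)$.
   Formalization: Part (iv) is proved under the condition L+1/(n-1)≠0, as in (ii) and (iii); without it (iv) fails, e.g. on S²×R with n=3, L=-1/2. *)

(* Defs.v *)
From HB Require Import structures.
From mathcomp Require Import all_boot all_order all_algebra.
From mathcomp Require Import all_classical all_reals all_analysis.
Set Implicit Arguments.
Unset Strict Implicit.
Unset Printing Implicit Defensive.
Import Order.TTheory GRing.Theory Num.Theory.
Import numFieldNormedType.Exports.
Local Open Scope classical_set_scope.
Local Open Scope ring_scope.

Definition evec (R : realType) (n : nat) (a : 'I_n) : 'rV[R]_n := delta_mx 0 a.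

Definition pderiv (R : realType) (n : nat) (a : 'I_n) (f : 'rV[R]_n -> R) :
  'rV[R]_n -> R := fun x => 'D_(evec R a) f x.

(* Only meant for an open U. *)
Fixpoint Ck_on (R : realType) (n k : nat) (U : set 'rV[R]_n)
    (f : 'rV[R]_n -> R) : Prop :=
  (forall x, U x -> {for x, continuous f}) /\
  match k with
  | 0 => True
  | k'.+1 => forall a : 'I_n,
      (forall x, U x -> derivable f x (evec R a)) /\ Ck_on k' U (pderiv a f)
  end.

Definition smooth_on (R : realType) (n : nat) (U : set 'rV[R]_n)
    (f : 'rV[R]_n -> R) : Prop :=
  forall k : nat, Ck_on k U f.

(* The atlas need not be maximal; the values of [chart_map i] off
   [chart_dom i] and of [chart_inv i] off [chart_codom i] are irrelevant. *)

Record smooth_manifold (R : realType) (n : nat) := SmoothManifold {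
  mcarrier :> topologicalType;
  chart_index : Type;
  chart_dom : chart_index -> set mcarrier;
  chart_map : chart_index -> mcarrier -> 'rV[R]_n;
  chart_inv : chart_index -> 'rV[R]_n -> mcarrier;
  m_hausdorff : hausdorff_space mcarrier;
  m_second_countable : @second_countable mcarrier;
  m_connected : connected [set: mcarrier];
  chart_cover : forall p : mcarrier, exists i, chart_dom i p;
  chart_dom_open : forall i, open (chart_dom i);
  chart_codom_open : forall i, open (chart_map i @` chart_dom i);
  chart_mapK : forall i p, chart_dom i p -> chart_inv i (chart_map i p) = p;
  chart_map_continuous : forall i p,
    chart_dom i p -> {for p, continuous (chart_map i)};
  chart_inv_continuous : forall i x,
    (chart_map i @` chart_dom i) x -> {for x, continuous (chart_inv i)};
  transition_smooth : forall i j (b : 'I_n),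
    smooth_on (chart_map i @` (chart_dom i `&` chart_dom j))
              (fun x => chart_map j (chart_inv i x) 0 b)
}.

Definition chart_codom (R : realType) (n : nat) (M : smooth_manifold R n)
    (i : chart_index M) : set 'rV[R]_n :=
  chart_map i @` chart_dom i.

Definition smooth_function (R : realType) (n : nat) (M : smooth_manifold R n)
    (f : M -> R) : Prop :=
  forall i : chart_index M, smooth_on (chart_codom i) (f \o @chart_inv R n M i).

Definition transition_jacobian (R : realType) (n : nat)
    (M : smooth_manifold R n) (i j : chart_index M) (x : 'rV[R]_n) : 'M[R]_n :=
  \matrix_(a, b) pderiv a (fun y => chart_map j (chart_inv i y) 0 b) x.

(* [gram g i x] is the Gram matrix of the metric in the coordinate frame of the
   chart i at the point of coordinates x.  Any signature is allowed; since the
   manifold is connected, nondegeneracy makes the index constant. *)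
Record semi_riemannian_metric (R : realType) (n : nat)
    (M : smooth_manifold R n) := SemiRiemannianMetric {
  gram : chart_index M -> 'rV[R]_n -> 'M[R]_n;
  gram_smooth : forall i (a b : 'I_n),
    smooth_on (chart_codom i) (fun x => gram i x a b);
  gram_sym : forall i x, chart_codom i x -> (gram i x)^T = gram i x;
  gram_nondegenerate : forall i x, chart_codom i x -> gram i x \in unitmx;
  gram_change : forall i j p, chart_dom i p -> chart_dom j p ->
    gram i (chart_map i p) =
      transition_jacobian i j (chart_map i p) *m gram j (chart_map j p)
        *m (transition_jacobian i j (chart_map i p))^T
}.

(* A tangent vector is the row of its components in
   the coordinate frame of a chart, and h is the Gram matrix of the metric at the point. *)

Definition gform (R : realType) (n : nat) (h : 'M[R]_n) (u v : 'rV[R]_n) : R :=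
  (u *m h *m v^T) 0 0.

Definition gtrace (R : realType) (n : nat) (h : 'M[R]_n)
    (A : 'rV[R]_n -> 'rV[R]_n -> R) : R :=
  \sum_(a < n) \sum_(b < n) invmx h a b * A (evec R a) (evec R b).

(* The vector w such that gform h w v = theta v for all v (theta linear). *)
Definition graise (R : realType) (n : nat) (h : 'M[R]_n)
    (theta : 'rV[R]_n -> R) : 'rV[R]_n :=
  \row_(b < n) \sum_(a < n) theta (evec R a) * invmx h a b.

Definition KN (R : realType) (n : nat) (A F : 'rV[R]_n -> 'rV[R]_n -> R)
    (X1 X2 X3 X4 : 'rV[R]_n) : R :=
  A X1 X4 * F X2 X3 + A X2 X3 * F X1 X4
  - A X1 X3 * F X2 X4 - A X2 X4 * F X1 X3.

Definition act11 (R : realType) (n : nat) (l H : 'rV[R]_n -> 'rV[R]_n)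
    (X1 : 'rV[R]_n) : 'rV[R]_n :=
  l (H X1) - H (l X1).

Definition act13 (R : realType) (n : nat) (l : 'rV[R]_n -> 'rV[R]_n)
    (H : 'rV[R]_n -> 'rV[R]_n -> 'rV[R]_n -> 'rV[R]_n)
    (X1 X2 X3 : 'rV[R]_n) : 'rV[R]_n :=
  l (H X1 X2 X3) - (H (l X1) X2 X3 + H X1 (l X2) X3 + H X1 X2 (l X3)).

Definition wedge_op (R : realType) (n : nat) (A : 'rV[R]_n -> 'rV[R]_n -> R)
    (X Y Z : 'rV[R]_n) : 'rV[R]_n :=
  A Y Z *: X - A X Z *: Y.

Definition Qten11 (R : realType) (n : nat) (A : 'rV[R]_n -> 'rV[R]_n -> R)
    (H : 'rV[R]_n -> 'rV[R]_n) (X1 X Y : 'rV[R]_n) : 'rV[R]_n :=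
  act11 (wedge_op A X Y) H X1.

Definition Qten13 (R : realType) (n : nat) (A : 'rV[R]_n -> 'rV[R]_n -> R)
    (H : 'rV[R]_n -> 'rV[R]_n -> 'rV[R]_n -> 'rV[R]_n)
    (X1 X2 X3 X Y : 'rV[R]_n) : 'rV[R]_n :=
  act13 (wedge_op A X Y) H X1 X2 X3.

(* From here on, G is the Gram matrix of the metric as a function
   of the coordinates, x a point. *)

(* The c-th component of nabla_{d_a} d_b. *)
Definition christoffel (R : realType) (n : nat) (G : 'rV[R]_n -> 'M[R]_n)
    (a b c : 'I_n) (x : 'rV[R]_n) : R :=
  2^-1 * \sum_(d < n) invmx (G x) c d *
    (pderiv a (fun y => G y b d) x + pderiv b (fun y => G y a d) x
     - pderiv d (fun y => G y a b) x).

(* The d-th component of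
   (nabla_{d_a} nabla_{d_b} - nabla_{d_b} nabla_{d_a}) d_c. *)
Definition riemann_coef (R : realType) (n : nat) (G : 'rV[R]_n -> 'M[R]_n)
    (a b c d : 'I_n) (x : 'rV[R]_n) : R :=
  pderiv a (christoffel G b c d) x - pderiv b (christoffel G a c d) x
  + \sum_(e < n) (christoffel G b c e x * christoffel G a e d x
                  - christoffel G a c e x * christoffel G b e d x).

Definition curv13 (R : realType) (n : nat) (G : 'rV[R]_n -> 'M[R]_n)
    (x X Y Z : 'rV[R]_n) : 'rV[R]_n :=
  \row_(d < n) \sum_(a < n) \sum_(b < n) \sum_(c < n)
    X 0 a * Y 0 b * Z 0 c * riemann_coef G a b c d x.

Definition curv (R : realType) (n : nat) (G : 'rV[R]_n -> 'M[R]_n)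
    (x X1 X2 X3 X4 : 'rV[R]_n) : R :=
  gform (G x) (curv13 G x X1 X2 X3) X4.

Definition ricci (R : realType) (n : nat) (G : 'rV[R]_n -> 'M[R]_n)
    (x X2 X3 : 'rV[R]_n) : R :=
  gtrace (G x) (fun X1 X4 => curv G x X1 X2 X3 X4).

Definition ricci_op (R : realType) (n : nat) (G : 'rV[R]_n -> 'M[R]_n)
    (x X : 'rV[R]_n) : 'rV[R]_n :=
  graise (G x) (ricci G x X).

Definition scalar_curv (R : realType) (n : nat) (G : 'rV[R]_n -> 'M[R]_n)
    (x : 'rV[R]_n) : R :=
  gtrace (G x) (ricci G x).

Definition ricci2 (R : realType) (n : nat) (G : 'rV[R]_n -> 'M[R]_n)
    (x X Y : 'rV[R]_n) : R :=
  gform (G x) (ricci_op G x (ricci_op G x X)) Y.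

Definition scalar_curv2 (R : realType) (n : nat) (G : 'rV[R]_n -> 'M[R]_n)
    (x : 'rV[R]_n) : R :=
  \tr (lin1_mx (ricci_op G x \o ricci_op G x)).

Definition Eten (R : realType) (n : nat) (G : 'rV[R]_n -> 'M[R]_n)
    (x X Y : 'rV[R]_n) : R :=
  gtrace (G x) (fun X1 X2 => curv G x X1 X Y (ricci_op G x X2)).

Definition proj (R : realType) (n : nat) (G : 'rV[R]_n -> 'M[R]_n)
    (x X1 X2 X3 X4 : 'rV[R]_n) : R :=
  curv G x X1 X2 X3 X4
  - (n%:R - 1)^-1 * (ricci G x X2 X3 * gform (G x) X1 X4
                     - ricci G x X1 X3 * gform (G x) X2 X4).

Definition proj13 (R : realType) (n : nat) (G : 'rV[R]_n -> 'M[R]_n)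
    (x X1 X2 X3 : 'rV[R]_n) : 'rV[R]_n :=
  graise (G x) (proj G x X1 X2 X3).

Definition Pdot11 (R : realType) (n : nat) (G : 'rV[R]_n -> 'M[R]_n)
    (x : 'rV[R]_n) (H : 'rV[R]_n -> 'rV[R]_n) (X1 X Y : 'rV[R]_n) :
    'rV[R]_n :=
  act11 (proj13 G x X Y) H X1.

Definition Pdot13 (R : realType) (n : nat) (G : 'rV[R]_n -> 'M[R]_n)
    (x : 'rV[R]_n) (H : 'rV[R]_n -> 'rV[R]_n -> 'rV[R]_n -> 'rV[R]_n)
    (X1 X2 X3 X Y : 'rV[R]_n) : 'rV[R]_n :=
  act13 (proj13 G x X Y) H X1 X2 X3.

(* Main.v *)
Require Import Defs.
From HB Require Import structures.
From mathcomp Require Import all_boot all_order all_algebra.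
From mathcomp Require Import all_classical all_reals all_analysis.
From mathcomp Require Import ring lra.
Import Order.TTheory GRing.Theory Num.Theory.
Import numFieldNormedType.Exports.
Set Implicit Arguments.
Unset Strict Implicit.
Unset Printing Implicit Defensive.
Local Open Scope ring_scope.

(** The statement is pointwise.  Put m = L + 1/(n-1) and
    l(X,Y) = R(X,Y) - m X /\_S Y.  Since the (1,3)-tensor P(X,Y) equals
    R(X,Y) - 1/(n-1) X /\_S Y, the hypothesis says that the derivation
    induced by l(X,Y) annihilates P.  Lower this equation with W and contract
    P over its two middle arguments: R(X,Y) is skew for g and drops out of the
    contraction, while X /\_S Y is not, and one is left with an identity
    between R, S, S^2 and g in four vectors X, Y, Z, W.  Its part skew in
    (Z, W) is m (S /\ S - g /\ S^2) = 0, which gives (iv) and, by contracting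
    twice, (ii); its trace over X, W is (i); and the hypothesis of (iii) says
    that its curvature terms carrying the factor m vanish.  The symmetries of R
    used on the way come from the torsion-freeness and metric compatibility of
    the Christoffel symbols and from the commutation of second partial
    derivatives. *)

(** * Symmetry of second derivatives *)

(** The one-variable mean value theorem applied to t -> f (x + t v), whose derivative at t is the
    directional derivative of [f] at x + t v. *)
Lemma MVT_line (R : realType) (V : normedModType R) (f : V -> R) (x v : V)
    (s : R) :
  0 <= s -> (forall t, 0 <= t <= s -> derivable f (x + t *: v) v) ->
  exists2 t, 0 <= t <= s & f (x + s *: v) - f x = s * 'D_v f (x + t *: v).
Proof.
move=> s0 df; pose phi (t : R) := f (x + t *: v).
have dphi t : 0 <= t <= s -> is_derive t 1 phi ('D_v f (x + t *: v)).
  move=> /df d.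
  (* The difference quotients of [phi] at t and of [f] at x + t v along [v] are the same function of
     h, so derivability and the value carry over together. *)
  have E : (fun h : R => h^-1 *: ((phi \o shift t) (h *: 1) - phi t)) =
           (fun h : R => h^-1 *: ((f \o shift (x + t *: v)) (h *: v)
                                    - f (x + t *: v))).
    apply/funext => h; rewrite /phi /= [_%:A]mulr1 scalerDl.
    by rewrite addrCA.
  by split; rewrite /derivable /derive E.
have [||t tI ht] := @MVT_segment R phi (fun t => 'D_v f (x + t *: v)) 0 s s0.
- by move=> t; rewrite in_itv /= => /andP[t0 ts]; apply: dphi; rewrite !ltW.
- apply: derivable_within_continuous => t; rewrite in_itv /= => tI.
  exact: (@ex_derive _ _ _ _ _ _ _ (dphi t tI)).
exists t; first by move: tI; rewrite in_itv.
by move: ht; rewrite /phi scale0r addr0 subr0 mulrC.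
Qed.

(** The second difference is the increment along [v] of u(y) = f (y + s w) - f y: one mean value
    theorem handles the [v] direction, a second one, for the derivative of [f] along [v], the [w]
    direction. The bound on [s] keeps the whole parallelogram inside the ball of radius [r]. *)
Lemma second_difference_MVT (R : realType) (V : normedModType R) (f : V -> R)
    (x v w : V) (r s : R) :
  0 <= s -> s * (`|v| + `|w|) < r ->
  (forall y, `|x - y| < r -> derivable f y v) ->
  (forall y, `|x - y| < r -> derivable ('D_v f) y w) ->
  exists2 y, `|x - y| < r &
    f (x + s *: w + s *: v) - f (x + s *: w) - (f (x + s *: v) - f x)
      = s * (s * 'D_w ('D_v f) y).
Proof.
move=> s0 sr df ddf.
have near_x t u : 0 <= t <= s -> 0 <= u <= s -> `|x - (x + t *: v + u *: w)| < r.
  move=> /andP[t0 ts] /andP[u0 us]; apply: le_lt_trans sr.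
  rewrite -addrA opprD addNKr normrN mulrDr (le_trans (ler_normD _ _))//.
  by rewrite !normrZ !ger0_norm// lerD// ler_wpM2r.
have near_x0 t : 0 <= t <= s -> `|x - (x + t *: v)| < r.
  by move=> tI; have := near_x t 0 tI; rewrite scale0r addr0 lexx; apply.
have ss : 0 <= s <= s by rewrite s0 lexx.
pose u := fun y : V => f (y + s *: w) - f y.
have dshift y : derivable f (y + s *: w) v ->
    is_derive y v (fun z => f (z + s *: w)) ('D_v f (y + s *: w)).
  move=> d.
  have E : (fun h : R => h^-1 *: (((fun z => f (z + s *: w)) \o shift y) (h *: v)
              - f (y + s *: w))) =
           (fun h : R => h^-1 *: ((f \o shift (y + s *: w)) (h *: v)
                                    - f (y + s *: w))).
    by apply/funext => h; rewrite /= addrA.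
  by split; rewrite /derivable /derive E.
have du t : 0 <= t <= s -> is_derive (x + t *: v) v u
    ('D_v f (x + t *: v + s *: w) - 'D_v f (x + t *: v)).
  move=> tI; apply: is_deriveB; last by apply/derivableP/df/near_x0.
  by apply/dshift/df/near_x.
have [t tI ht] := MVT_line s0 (fun t tI => @ex_derive _ _ _ _ _ _ _ (du t tI)).
have [|p pI hp] := @MVT_line _ _ ('D_v f) (x + t *: v) w s s0.
  by move=> p pI; apply/ddf/near_x.
exists (x + t *: v + p *: w); first exact: near_x.
rewrite -hp -(@derive_val _ _ _ _ _ _ _ (du t tI)) -ht /u.
rewrite (addrAC x (s *: v)); lra.
Qed.

Lemma ler_distD_half (R : realFieldType) (a b c e : R) :
  `|a - c| < e / 2 -> `|b - c| < e / 2 -> `|a - b| <= e.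
Proof.
move=> ac bc; rewrite [e]splitr (le_trans (ler_distD c a b))//.
by rewrite lerD// ltW// distrC.
Qed.

(** The second difference over a parallelogram is symmetric in [v] and [w]. Hence the two mixed
    derivatives take a common value at some points y and z near x, and their continuity at x brings
    the values at x within any [e] of each other. *)
Lemma derive_comm (R : realType) (V : normedModType R) (f : V -> R)
    (x v w : V) :
  (\near x, derivable f x v) -> (\near x, derivable f x w) ->
  (\near x, derivable ('D_v f) x w) -> (\near x, derivable ('D_w f) x v) ->
  {for x, continuous ('D_w ('D_v f))} -> {for x, continuous ('D_v ('D_w f))} ->
  'D_w ('D_v f) x = 'D_v ('D_w f) x.
Proof.
move=> dv dw dvw dwv cvw cwv.
apply/eqP; rewrite -subr_eq0 -normr_le0.
apply/ler_addgt0Pl => e e0; rewrite addr0.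
have e20 : 0 < e / 2 by rewrite divr_gt0.
have near_all : \forall y \near x, [/\ derivable f y v, derivable f y w,
    derivable ('D_v f) y w, derivable ('D_w f) y v &
    `|'D_w ('D_v f) x - 'D_w ('D_v f) y| < e / 2 /\
    `|'D_v ('D_w f) x - 'D_v ('D_w f) y| < e / 2].
  have ev := @cvgr_dist_lt _ _ _ _ (nbhs_filter x) ('D_w ('D_v f))
    ('D_w ('D_v f) x) cvw _ e20.
  have ew := @cvgr_dist_lt _ _ _ _ (nbhs_filter x) ('D_v ('D_w f))
    ('D_v ('D_w f) x) cwv _ e20.
  apply: (@filterS _ _ (nbhs_filter x) _ _ _ (filterI
    (filterI (filterI dv dw) (filterI dvw dwv)) (filterI ev ew))).
  move=> y [[[a b] [c d]] [p q]].
  exact: And5 a b c d (conj p q).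
have [r /= r0 ball_all] := (nbhs_normP _ _).1 near_all.
(* The summand 1 keeps [q] positive when both vectors vanish, and s q = r / 2 stays below the
   radius. *)
pose q := `|v| + `|w| + 1; pose s := r / (q * 2).
have q0 : 0 < q by rewrite /q ltr_wpDl// addr_ge0.
have s0 : 0 < s by rewrite /s divr_gt0// mulr_gt0.
have sr : s * (`|v| + `|w|) < r.
  apply: (@lt_le_trans _ _ (s * q)); first by rewrite ltr_pM2l// /q ltrDl.
  rewrite /s invfM mulrA mulrAC divfK ?gt_eqF//; lra.
have [||y yr hy] := @second_difference_MVT _ _ f x v w r s (ltW s0) sr.
- by move=> y /ball_all[].
- by move=> y /ball_all[].
have [|||z zr hz] := @second_difference_MVT _ _ f x w v r s (ltW s0).
- by rewrite addrC.
- by move=> z /ball_all[].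
- by move=> z /ball_all[].
have yz : 'D_w ('D_v f) y = 'D_v ('D_w f) z.
  have : s * (s * 'D_w ('D_v f) y) = s * (s * 'D_v ('D_w f) z).
    have swap (a b c d : R) : a - b - (c - d) = a - c - (b - d) by ring.
    by rewrite -hy -hz (addrAC x (s *: v)); exact: swap.
  by move/(mulfI (lt0r_neq0 s0))/(mulfI (lt0r_neq0 s0)).
have [_ _ _ _ [ey _]] := ball_all _ yr.
have [_ _ _ _ [_ ez]] := ball_all _ zr.
by rewrite -yz in ez; exact: ler_distD_half ey ez.
Qed.

(** * Curvature of the Levi-Civita connection in coordinates *)

Lemma smooth_on_continuous (R : realType) (n : nat) (U : set 'rV[R]_n)
    (f : 'rV[R]_n -> R) (x : 'rV[R]_n) :
  smooth_on U f -> U x -> {for x, continuous f}.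
Proof. by move=> /(_ 0%N)[cf _] Ux; exact: cf. Qed.

Lemma smooth_on_derivable (R : realType) (n : nat) (U : set 'rV[R]_n)
    (f : 'rV[R]_n -> R) (a : 'I_n) (x : 'rV[R]_n) :
  smooth_on U f -> U x -> derivable f x (evec R a).
Proof. by move=> /(_ 1%N)[_ /(_ a)[df _]] Ux; exact: df. Qed.

Lemma smooth_on_pderiv (R : realType) (n : nat) (U : set 'rV[R]_n)
    (f : 'rV[R]_n -> R) (a : 'I_n) :
  smooth_on U f -> smooth_on U (pderiv a f).
Proof. by move=> sf k; have [_ /(_ a)[]] := sf k.+1. Qed.

Lemma near_open (T : topologicalType) (U : set T) (P : T -> Prop) (x : T) :
  open U -> U x -> (forall y, U y -> P y) -> \forall y \near x, P y.
Proof.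
move=> oU Ux UP; apply: (@filterS _ _ (nbhs_filter x) _ _ UP).
exact: open_nbhs_nbhs.
Qed.

Lemma pderiv_comm (R : realType) (n : nat) (U : set 'rV[R]_n)
    (f : 'rV[R]_n -> R) (a b : 'I_n) (x : 'rV[R]_n) :
  open U -> smooth_on U f -> U x ->
  pderiv a (pderiv b f) x = pderiv b (pderiv a f) x.
Proof.
move=> oU sf Ux; apply: derive_comm.
- by apply: (near_open oU Ux) => y; apply: smooth_on_derivable.
- by apply: (near_open oU Ux) => y; apply: smooth_on_derivable.
- apply: (near_open oU Ux) => y; apply: (@smooth_on_derivable _ _ U (pderiv b f)).
  exact: smooth_on_pderiv.
- apply: (near_open oU Ux) => y; apply: (@smooth_on_derivable _ _ U (pderiv a f)).
  exact: smooth_on_pderiv.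
- apply: (@smooth_on_continuous _ _ U (pderiv a (pderiv b f))) Ux.
  by do 2!apply: smooth_on_pderiv.
- apply: (@smooth_on_continuous _ _ U (pderiv b (pderiv a f))) Ux.
  by do 2!apply: smooth_on_pderiv.
Qed.

Lemma eq_on_pderiv (R : realType) (n : nat) (U : set 'rV[R]_n)
    (f g : 'rV[R]_n -> R) (a : 'I_n) (x : 'rV[R]_n) :
  open U -> U x -> (forall y, U y -> f y = g y) -> pderiv a f x = pderiv a g x.
Proof. by move=> oU Ux fg; apply: near_eq_derive; exact: near_open fg. Qed.

(** * Derivatives of finite sums, products, determinants and cofactors *)

Section derivable_big.
Variables (R : realType) (V : normedModType R) (x v : V).

Lemma derivable_bigsum (I : Type) (r : seq I) (P : pred I) (F : I -> V -> R) :
  (forall i, P i -> derivable (F i) x v) ->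
  derivable (fun y => \sum_(i <- r | P i) F i y) x v.
Proof.
move=> dF; elim: r => [|i r IH].
  by under eq_fun do rewrite big_nil; exact: derivable_cst.
under eq_fun do rewrite big_cons.
case: ifPn => [Pi|_]; last exact: IH.
exact: (derivableD (dF i Pi) IH).
Qed.

Lemma derivable_bigprod (I : Type) (r : seq I) (P : pred I) (F : I -> V -> R) :
  (forall i, P i -> derivable (F i) x v) ->
  derivable (fun y => \prod_(i <- r | P i) F i y) x v.
Proof.
move=> dF; elim: r => [|i r IH].
  by under eq_fun do rewrite big_nil; exact: derivable_cst.
under eq_fun do rewrite big_cons.
case: ifPn => [Pi|_]; last exact: IH.
exact: (derivableM (dF i Pi) IH).
Qed.

Lemma derive_bigsum (I : Type) (r : seq I) (F : I -> V -> R) :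
  (forall i, derivable (F i) x v) ->
  'D_v (fun y => \sum_(i <- r) F i y) x = \sum_(i <- r) 'D_v (F i) x.
Proof.
move=> dF; elim: r => [|i r IH].
  by under eq_fun do rewrite big_nil; rewrite derive_cst big_nil.
under eq_fun do rewrite big_cons.
rewrite big_cons -IH; apply: deriveD; first exact: dF.
by apply: derivable_bigsum => j _; exact: dF.
Qed.

(** By the Leibniz formula the determinant is a sum of constants times products of entries. *)
Lemma derivable_det (n : nat) (M : V -> 'M[R]_n) :
  (forall i j, derivable (fun y => M y i j) x v) ->
  derivable (fun y => \det (M y)) x v.
Proof.
move=> dM; apply: derivable_bigsum => s _.
apply: (@derivableM _ _ (cst _)); first exact: derivable_cst.
by apply: derivable_bigprod => i _; apply: dM.
Qed.

Lemma derivable_cofactor (n : nat) (M : V -> 'M[R]_n) (i j : 'I_n) :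
  (forall i j, derivable (fun y => M y i j) x v) ->
  derivable (fun y => cofactor (M y) i j) x v.
Proof.
move=> dM; apply: (@derivableM _ _ (cst _)); first exact: derivable_cst.
apply: derivable_det => k l.
under eq_fun do rewrite !mxE.
exact: dM.
Qed.

End derivable_big.

(** * The Levi-Civita connection and the symmetries of its curvature components *)

Section levi_civita.
Variables (R : realType) (n : nat) (U : set 'rV[R]_n) (G : 'rV[R]_n -> 'M[R]_n).
Hypothesis oU : open U.
Hypothesis smoothG : forall a b, smooth_on U (fun y => G y a b).
Hypothesis symG : forall y, U y -> (G y)^T = G y.
Hypothesis unitG : forall y, U y -> G y \in unitmx.

Let symGE y a b : U y -> G y a b = G y b a.
Proof. by move=> Uy; rewrite -{1}(symG Uy) mxE. Qed.

Lemma derivable_invmx a c d y : U y ->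
  derivable (fun z => invmx (G z) c d) y (evec R a).
Proof.
move=> Uy.
have dG i j : derivable (fun z => G z i j) y (evec R a).
  exact: smooth_on_derivable (smoothG i j) Uy.
(* Cramer's rule describes [invmx] only at invertible matrices; since [U] is open it holds near [y],
   which is enough. The adjugate transposes the cofactors, whence the order [d c]. *)
apply: (@near_eq_derivable _ _ _
  (fun z => (\det (G z))^-1 * cofactor (G z) d c)).
  by apply: near_open oU Uy _ => z Uz; rewrite /invmx unitG// !mxE.
apply: derivableM; last exact: derivable_cofactor.
apply: derivableV; last exact: derivable_det.
by have := unitG Uy; rewrite unitmxE unitfE.
Qed.

(** The Christoffel symbols of the first kind, g(nabla_a d_b, d_d); this form contains no inverse
    matrix, so its derivatives involve only those of [G]. *)
Definition christoffel_low a b d (y : 'rV[R]_n) : R :=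
  2^-1 * (pderiv a (fun y => G y b d) y + pderiv b (fun y => G y a d) y
     - pderiv d (fun y => G y a b) y).

Lemma derivable_pderivG e a b c y : U y ->
  derivable (pderiv a (fun y => G y b c)) y (evec R e).
Proof.
by move=> Uy; apply: smooth_on_derivable Uy; apply: smooth_on_pderiv.
Qed.

Lemma derivable_christoffel_low e a b d y : U y ->
  derivable (christoffel_low a b d) y (evec R e).
Proof.
move=> Uy; apply: (@derivableM _ _ (cst _)); first exact: derivable_cst.
apply: derivableB; last exact: derivable_pderivG.
by apply: derivableD; exact: derivable_pderivG.
Qed.

Lemma derivable_christoffel e a b c y : U y ->
  derivable (christoffel G a b c) y (evec R e).
Proof.
move=> Uy; apply: (@derivableM _ _ (cst _)); first exact: derivable_cst.
apply: derivable_bigsum => d _.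
apply: derivableM; first exact: derivable_invmx.
apply: derivableB; last exact: derivable_pderivG.
by apply: derivableD; exact: derivable_pderivG.
Qed.

Lemma christoffel_sym a b c y : U y -> christoffel G a b c y = christoffel G b a c y.
Proof.
move=> Uy; rewrite /christoffel; congr (_ * _); apply: eq_bigr => d _.
rewrite (@eq_on_pderiv _ _ U (fun y => G y a b) (fun y => G y b a))//.
  by rewrite (addrC (pderiv a _ y)).
by move=> z; apply: symGE.
Qed.

Lemma christoffel_lowE a b d y : U y ->
  \sum_c christoffel G a b c y * G y c d = christoffel_low a b d y.
Proof.
move=> Uy; rewrite /christoffel /christoffel_low.
set k := fun d => pderiv a (fun y => G y b d) y + pderiv b (fun y => G y a d) y
   - pderiv d (fun y => G y a b) y.
have invT c e : invmx (G y) c e = invmx (G y) e c.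
  by rewrite -{1}(symG Uy) -trmx_inv mxE.
have sum_inv e : \sum_c invmx (G y) c e * G y c d = (e == d)%:R.
  under eq_bigr do rewrite invT.
  by have := mulVmx (unitG Uy) => /matrixP/(_ e d); rewrite !mxE.
transitivity (\sum_c \sum_e 2^-1 * k e * (invmx (G y) c e * G y c d)).
  apply: eq_bigr => c _; rewrite mulr_sumr mulr_suml; apply: eq_bigr => e _.
  by rewrite /k; ring.
rewrite exchange_big /= (bigD1 d)//= [X in _ + X]big1 ?addr0 => [|e ed].
  by rewrite -mulr_sumr sum_inv eqxx mulr1.
by rewrite -mulr_sumr sum_inv (negbTE ed) mulr0.
Qed.

(** This is nabla g = 0 in the coordinate frame: d_a g(d_b, d_c) is the sum of g(nabla_a d_b, d_c)
    and g(d_b, nabla_a d_c). *)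
Lemma metric_compat a b c y : U y ->
  christoffel_low a b c y + christoffel_low a c b y = pderiv a (fun y => G y b c) y.
Proof.
move=> Uy; rewrite /christoffel_low.
rewrite (@eq_on_pderiv _ _ U (fun y => G y c b) (fun y => G y b c))//; first lra.
by move=> z; apply: symGE.
Qed.

Definition riemann_low a b c d (y : 'rV[R]_n) : R :=
  \sum_e riemann_coef G a b c e y * G y e d.

Lemma riemann_coef_skew12 a b c d y :
  riemann_coef G a b c d y = - riemann_coef G b a c d y.
Proof.
rewrite /riemann_coef opprD opprB -sumrN; congr (_ + _).
by apply: eq_bigr => e _; rewrite opprB.
Qed.

(** Torsion-freeness, in the form of the symmetry of the Christoffel symbols in their first two
    indices, makes both the derivative terms and the quadratic terms cancel around the cycle. *)
Lemma riemann_coef_bianchi a b c d y : U y ->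
  riemann_coef G a b c d y + riemann_coef G b c a d y
    + riemann_coef G c a b d y = 0.
Proof.
move=> Uy; rewrite /riemann_coef.
have swap i j k e :
    pderiv i (christoffel G j k e) y = pderiv i (christoffel G k j e) y.
  by apply: (eq_on_pderiv _ oU Uy) => z; apply: christoffel_sym.
have cycle (p q r s t u : R) : s + t + u = 0 ->
    p - q + s + (q - r + t) + (r - p + u) = 0.
  by move=> stu; rewrite -[RHS]stu; ring.
rewrite (swap b c a) (swap c b a) (swap a c b); apply: cycle.
rewrite -!big_split /= big1// => e _.
rewrite (christoffel_sym c b e Uy) (christoffel_sym c a e Uy).
have cycle0 (p q r s t u : R) :
    p * q - r * s + (r * s - t * u) + (t * u - p * q) = 0 by ring.
by rewrite (christoffel_sym b a e Uy); exact: cycle0.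
Qed.

(** This is g(nabla_b d_c, nabla_a d_d); its symmetry below is that of g. *)
Let K b c a d y := \sum_e christoffel G b c e y * christoffel_low a d e y.

Let K_sym b c a d y : U y -> K b c a d y = K a d b c y.
Proof.
move=> Uy; rewrite /K.
under eq_bigr do rewrite -christoffel_lowE// mulr_sumr.
under [RHS]eq_bigr do rewrite -christoffel_lowE// mulr_sumr.
rewrite exchange_big; apply: eq_bigr => e _; apply: eq_bigr => f _ /=.
by rewrite (symGE e f Uy); ring.
Qed.

(** Metric compatibility gives g(nabla_a nabla_b d_c, d_d) = d_a g(nabla_b d_c, d_d) - g(nabla_b
    d_c, nabla_a d_d); skew-symmetrizing in a and b gives the curvature. *)
Lemma riemann_lowE a b c d y : U y ->
  riemann_low a b c d y =
    pderiv a (christoffel_low b c d) y - pderiv b (christoffel_low a c d) y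
    - K b c a d y + K a c b d y.
Proof.
move=> Uy.
have half i j : \sum_e pderiv i (christoffel G j c e) y * G y e d
    + \sum_e christoffel G j c e y * christoffel_low i e d y
    = pderiv i (christoffel_low j c d) y - K j c i d y.
  rewrite -(@eq_on_pderiv _ _ U
    (fun y => \sum_e christoffel G j c e y * G y e d))//; last first.
    by move=> z; apply: christoffel_lowE.
  have dC e : derivable (fun y => christoffel G j c e y * G y e d) y (evec R i).
    apply: derivableM; first exact: derivable_christoffel.
    exact: smooth_on_derivable (smoothG e d) Uy.
  rewrite /pderiv (derive_bigsum _ dC) /K -sumrB -big_split.
  apply: eq_bigr => e _ /=.
  rewrite (deriveM (f := christoffel G j c e)); last 2 first.
  - exact: derivable_christoffel.
  - exact: smooth_on_derivable (smoothG e d) Uy.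
  rewrite -[derive _ _ _ in X in _ = X - _](metric_compat i e d Uy).
  by rewrite /GRing.scale /=; ring.
have quad i j : \sum_e christoffel G j c e y * christoffel_low i e d y
   = \sum_e (\sum_f christoffel G j c f y * christoffel G i f e y) * G y e d.
  under [RHS]eq_bigr do rewrite mulr_suml.
  rewrite exchange_big; apply: eq_bigr => e _ /=.
  by rewrite -christoffel_lowE// mulr_sumr; apply: eq_bigr => f _; rewrite mulrA.
(* [T i j] is g(nabla_i nabla_j d_c, d_d). *)
pose T i j := \sum_e (pderiv i (christoffel G j c e) y * G y e d
  + (\sum_f christoffel G j c f y * christoffel G i f e y) * G y e d).
have TE i j : T i j = pderiv i (christoffel_low j c d) y - K j c i d y.
  by rewrite -half quad /T big_split.
have -> : riemann_low a b c d y = T a b - T b a.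
  have distr (p q s t r : R) :
      (p - q + (s - t)) * r = p * r + s * r - (q * r + t * r).
    by ring.
  by rewrite /T -sumrB; apply: eq_bigr => e _; rewrite /riemann_coef sumrB distr.
have reorder (p q s t : R) : p - s - (q - t) = p - q - s + t by ring.
by rewrite !TE reorder.
Qed.

(** On adding the two sides the [K] terms cancel by symmetry, and by [metric_compat] the rest is the
    commutator of d_a and d_b applied to g_cd, which vanishes. *)
Lemma riemann_low_skew34 a b c d y : U y ->
  riemann_low a b c d y = - riemann_low a b d c y.
Proof.
move=> Uy; rewrite !riemann_lowE// (K_sym b c a d Uy) (K_sym a c b d Uy).
have sumL i j :
    pderiv i (christoffel_low j c d) y + pderiv i (christoffel_low j d c) y
    = pderiv i (pderiv j (fun y => G y c d)) y.
  rewrite -(@eq_on_pderiv _ _ U (christoffel_low j c d + christoffel_low j d c)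
    (pderiv j (fun y => G y c d)) i y oU Uy (@metric_compat j c d)).
  by rewrite /pderiv deriveD//; exact: derivable_christoffel_low.
have := sumL a b; have := sumL b a.
rewrite (pderiv_comm a b oU (smoothG c d) Uy).
have solve (p q r s t k k' : R) : p + q = t -> r + s = t ->
    r - p - k + k' = - (s - q - k' + k).
  by move=> <- /eqP; rewrite -subr_eq0 => /eqP rs; rewrite -[LHS]subr0 -rs; ring.
exact: solve.
Qed.

End levi_civita.

(** * Metric contractions *)

Section scalar_predicate.
Variables (R : pzRingType) (V : lmodType R) (f : V -> R).
Hypothesis scal_f : scalar f.
(** Packing the hypothesis as a linear structure lets the general lemmas on linear maps apply to
    functions obtained by fixing arguments of a tensor. *)
Let f' : {scalar V} := HB.pack f (GRing.isLinear.Build _ _ _ _ f scal_f).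

Lemma is_scalarD u v : f (u + v) = f u + f v. Proof. exact: (linearD f'). Qed.

Lemma is_scalarB u v : f (u - v) = f u - f v. Proof. exact: (linearB f'). Qed.

Lemma is_scalarN u : f (- u) = - f u. Proof. exact: (linearN f'). Qed.

Lemma is_scalarZ a u : f (a *: u) = a * f u. Proof. exact: (linearZ_LR f'). Qed.

Lemma is_scalar_sum (I : Type) (r : seq I) (F : I -> V) :
  f (\sum_(i <- r) F i) = \sum_(i <- r) f (F i).
Proof. exact: (linear_sum f'). Qed.

End scalar_predicate.

Section scalar_product.
Variables (R : realType) (n : nat) (h : 'M[R]_n).
Hypothesis symh : h^T = h.
Hypothesis unith : h \in unitmx.
Local Notation V := 'rV[R]_n.
Implicit Types (u v w x : V) (A B : V -> V -> R).
Local Notation g := (gform h).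
Local Notation tr := (gtrace h).

Lemma row_sum_evec u : u = \sum_a u 0 a *: evec R a.
Proof. exact: row_sum_delta. Qed.

Lemma gform_linear_l x : scalar (fun u => g u x).
Proof. by move=> a u v; rewrite /gform !mulmxDl -!scalemxAl !mxE. Qed.

Lemma gform_sym u v : g u v = g v u.
Proof.
rewrite /gform -[v *m h *m u^T]trmxK [in RHS]mxE.
by rewrite !trmx_mul trmxK symh mulmxA.
Qed.

Lemma gform_linear_r x : scalar (g x).
Proof. by move=> a u v; rewrite !(gform_sym x) gform_linear_l. Qed.

Lemma gformE u v : g u v = \sum_a \sum_b h a b * (u 0 a * v 0 b).
Proof.
rewrite /gform mxE exchange_big; apply: eq_bigr => b _ /=.
rewrite !mxE mulr_suml; apply: eq_bigr => a _; ring.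
Qed.

Lemma gform_evec_l a v : g (evec R a) v = (h *m v^T) a 0.
Proof. by rewrite /gform -mulmxA -rowE mxE. Qed.

Lemma invmx_sym a b : invmx h a b = invmx h b a.
Proof. by rewrite -{1}symh -trmx_inv mxE. Qed.

Lemma sum_invmx_gform b v : \sum_a invmx h a b * g (evec R a) v = v 0 b.
Proof.
under eq_bigr do rewrite gform_evec_l invmx_sym.
by have := mulKmx unith v^T => /matrixP/(_ b 0); rewrite !mxE.
Qed.

Lemma eq_gtrace A B : (forall u v, A u v = B u v) -> tr A = tr B.
Proof. by move=> AB; do 2!(apply: eq_bigr => ? _); rewrite AB. Qed.

Lemma gtraceD A B : tr (fun u v => A u v + B u v) = tr A + tr B.
Proof.
rewrite -big_split; apply: eq_bigr => a _; rewrite -big_split /=.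
by apply: eq_bigr => b _; rewrite mulrDr.
Qed.

Lemma gtraceZ c A : tr (fun u v => c * A u v) = c * tr A.
Proof.
rewrite mulr_sumr; apply: eq_bigr => a _; rewrite mulr_sumr.
by apply: eq_bigr => b _; rewrite mulrCA.
Qed.

Lemma gtraceN A : tr (fun u v => - A u v) = - tr A.
Proof. by rewrite -mulN1r -gtraceZ; apply: eq_gtrace => u v; rewrite mulN1r. Qed.

Lemma gtraceB A B : tr (fun u v => A u v - B u v) = tr A - tr B.
Proof. by rewrite gtraceD gtraceN. Qed.

Lemma gtrace_sym A : tr (fun u v => A v u) = tr A.
Proof.
rewrite /gtrace exchange_big; do 2!(apply: eq_bigr => ? _).
by rewrite invmx_sym.
Qed.

Lemma gtrace_exchange (A : V -> V -> V -> V -> R) :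
  tr (fun u v => tr (A u v)) = tr (fun x y => tr (fun u v => A u v x y)).
Proof.
pose t a b c d := invmx h a b * (invmx h c d *
  A (evec R a) (evec R b) (evec R c) (evec R d)).
transitivity (\sum_a \sum_b \sum_c \sum_d t a b c d).
  do 2!(apply: eq_bigr => ? _); rewrite mulr_sumr.
  by apply: eq_bigr => c _; rewrite mulr_sumr.
transitivity (\sum_c \sum_d \sum_a \sum_b t a b c d); last first.
  do 2!(apply: eq_bigr => ? _); rewrite mulr_sumr.
  apply: eq_bigr => c _; rewrite mulr_sumr; apply: eq_bigr => d _.
  by rewrite /t mulrCA.
rewrite pair_big /= [RHS]pair_big /=.
under eq_bigr do rewrite pair_big /=.
under [RHS]eq_bigr do rewrite pair_big /=.
exact: exchange_big.
Qed.

(** Contracting g with its inverse is the identity; this rule evaluates the trace of any term with a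
    factor g(u, x). *)
Lemma gtrace_gform_l (theta : V -> R) x :
  scalar theta -> tr (fun u v => g u x * theta v) = theta x.
Proof.
move=> lt; rewrite {2}(row_sum_evec x) is_scalar_sum// /gtrace exchange_big.
apply: eq_bigr => b _; rewrite is_scalarZ// -[in RHS]sum_invmx_gform mulr_suml.
by apply: eq_bigr => a _; rewrite mulrA.
Qed.

Lemma gtrace_gform_r (theta : V -> R) x :
  scalar theta -> tr (fun u v => theta u * g x v) = theta x.
Proof.
move=> lt; rewrite -gtrace_sym -[RHS]gtrace_gform_l//.
by apply: eq_gtrace => u v; rewrite mulrC gform_sym.
Qed.

Lemma gform_graise (theta : V -> R) v :
  scalar theta -> g (graise h theta) v = theta v.
Proof.
move=> lt; rewrite -[RHS]gtrace_gform_r// gform_sym (row_sum_evec (graise _ _)).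
rewrite is_scalar_sum; last exact: gform_linear_r.
rewrite /gtrace exchange_big; apply: eq_bigr => b _ /=.
rewrite (is_scalarZ (gform_linear_r v)) !mxE mulr_suml.
by apply: eq_bigr => a _; rewrite (mulrC (theta _)) mulrA.
Qed.

Lemma gform_inj u v : (forall w, g u w = g v w) -> u = v.
Proof.
by move=> uv; apply/rowP => b; rewrite -!sum_invmx_gform; apply: eq_bigr => a _;
  rewrite gform_sym uv gform_sym.
Qed.

Lemma gtrace_gform : tr g = n%:R.
Proof.
rewrite /gtrace exchange_big /=.
under eq_bigr do rewrite sum_invmx_gform.
under eq_bigr do rewrite /evec mxE !eqxx.
by rewrite sumr_const card_ord.
Qed.

Lemma gtrace_adjoint A (l l' : V -> V) :
  (forall v, scalar (fun u => A u v)) -> (forall u, scalar (A u)) ->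
  (forall u v, g (l u) v = g u (l' v)) ->
  tr (fun u v => A (l u) v) = tr (fun u v => A u (l' v)).
Proof.
move=> lA rA ll'.
(* The vector l u is expanded as a trace over (x, y) with coefficients g(u, l' x). After the traces
   are exchanged, the one over (u, v) contracts g away and leaves A(y, l' x). *)
transitivity (tr (fun u v => tr (fun x y => g u (l' x) * A y v))).
  apply: eq_gtrace => u v; rewrite -(gtrace_gform_l (l u) (lA v)).
  by apply: eq_gtrace => x y; rewrite gform_sym ll'.
rewrite gtrace_exchange.
transitivity (tr (fun x y => A y (l' x))); last exact: gtrace_sym.
by apply: eq_gtrace => x y; rewrite gtrace_gform_l.
Qed.

Lemma gtrace_skew A : (forall u v, A u v = - A v u) -> tr A = 0.
Proof.
move=> skewA; suff : tr A = - tr A by lra.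
by rewrite -{2}gtrace_sym -gtraceN; exact: eq_gtrace.
Qed.

Lemma gtrace_endo (l : V -> V) :
  linear l -> tr (fun u v => g (l u) v) = \tr (lin1_mx l).
Proof.
move=> ll; rewrite /gtrace /mxtrace; apply: eq_bigr => a _.
under eq_bigr do rewrite invmx_sym gform_sym.
by rewrite sum_invmx_gform mxE.
Qed.

End scalar_product.

(** * The curvature tensor at a point: multilinearity and symmetries *)

Section curvature_tensor.
Variables (R : realType) (n : nat) (U : set 'rV[R]_n) (G : 'rV[R]_n -> 'M[R]_n).
Hypothesis oU : open U.
Hypothesis smoothG : forall a b, smooth_on U (fun y => G y a b).
Hypothesis symG : forall y, U y -> (G y)^T = G y.
Hypothesis unitG : forall y, U y -> G y \in unitmx.
Variable x : 'rV[R]_n.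
Hypothesis Ux : U x.

Lemma curv13_linear1 Y Z : linear (fun X => curv13 G x X Y Z).
Proof.
move=> a u v; apply/rowP => d; rewrite !mxE mulr_sumr -big_split.
apply: eq_bigr => i _; rewrite mulr_sumr -big_split.
apply: eq_bigr => j _; rewrite mulr_sumr -big_split.
by apply: eq_bigr => k _; rewrite !mxE /=; ring.
Qed.

Lemma curv13_linear3 X Y : linear (curv13 G x X Y).
Proof.
move=> a u v; apply/rowP => d; rewrite !mxE mulr_sumr -big_split.
apply: eq_bigr => i _; rewrite mulr_sumr -big_split.
apply: eq_bigr => j _; rewrite mulr_sumr -big_split.
by apply: eq_bigr => k _; rewrite !mxE /=; ring.
Qed.

Lemma curv13_skew12 X Y Z : curv13 G x X Y Z = - curv13 G x Y X Z.
Proof.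
apply/rowP => d; rewrite !mxE exchange_big -sumrN; apply: eq_bigr => i _ /=.
rewrite -sumrN; apply: eq_bigr => j _; rewrite -sumrN; apply: eq_bigr => k _.
by rewrite riemann_coef_skew12; ring.
Qed.

Lemma curv13_bianchi X Y Z :
  curv13 G x X Y Z + curv13 G x Y Z X + curv13 G x Z X Y = 0.
Proof.
apply/rowP => d; rewrite !mxE.
(* Cyclic renaming of the summation indices brings all three sums to the factor X_a Y_b Z_c; the
   last sum needs it twice. *)
have cyc (A B C : 'rV[R]_n) (r : 'I_n -> 'I_n -> 'I_n -> R) :
    \sum_a \sum_b \sum_c B 0 a * C 0 b * A 0 c * r a b c =
    \sum_a \sum_b \sum_c A 0 a * B 0 b * C 0 c * r b c a.
  under eq_bigr do rewrite exchange_big.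
  rewrite exchange_big; do 3!(apply: eq_bigr => ? _) => /=; ring.
rewrite [X in _ + X + _]cyc [X in _ + _ + X]cyc [X in _ + _ + X]cyc.
rewrite -!big_split big1// => a _ /=; rewrite -!big_split big1// => b _ /=.
rewrite -!big_split big1// => c _ /=; rewrite -!mulrDr.
by rewrite (riemann_coef_bianchi oU symG)// mulr0.
Qed.

Lemma curvE X Y Z W : curv G x X Y Z W =
  \sum_a \sum_b \sum_c \sum_d
    X 0 a * Y 0 b * Z 0 c * W 0 d * riemann_low G a b c d x.
Proof.
have curv13E e : curv13 G x X Y Z 0 e = \sum_a \sum_b \sum_c
    X 0 a * Y 0 b * Z 0 c * riemann_coef G a b c e x by rewrite mxE.
rewrite /curv gformE.
under eq_bigr => e _ do (under eq_bigr do rewrite curv13E mulrCA;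
  rewrite -mulr_sumr mulr_suml).
rewrite exchange_big; apply: eq_bigr => a _ /=.
under eq_bigr do rewrite mulr_suml.
rewrite exchange_big; apply: eq_bigr => b _ /=.
under eq_bigr do rewrite mulr_suml.
rewrite exchange_big; apply: eq_bigr => c _ /=.
under eq_bigr do rewrite mulr_sumr.
rewrite exchange_big; apply: eq_bigr => d _ /=.
rewrite /riemann_low mulr_sumr; apply: eq_bigr => e _; ring.
Qed.

Lemma curv_skew34 X Y Z W : curv G x X Y Z W = - curv G x X Y W Z.
Proof.
rewrite !curvE -sumrN; apply: eq_bigr => a _; rewrite -sumrN.
apply: eq_bigr => b _; rewrite exchange_big -sumrN; apply: eq_bigr => c _ /=.
rewrite -sumrN; apply: eq_bigr => d _.
by rewrite (riemann_low_skew34 oU smoothG symG unitG)//; ring.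
Qed.

End curvature_tensor.

(** * Algebraic curvature tensors annihilated by l(X,Y) *)

Section curvature_algebra.
Variables (R : realType) (n : nat) (h : 'M[R]_n).
Hypothesis symh : h^T = h.
Hypothesis unith : h \in unitmx.
Local Notation V := 'rV[R]_n.
Local Notation g := (gform h).
Local Notation tr := (gtrace h).
Local Notation N := (n%:R : R).

Variable Rv : V -> V -> V -> V.
Local Notation Rm X Y Z W := (g (Rv X Y Z) W).
Hypothesis Rv_linear1 : forall Y Z, linear (fun X => Rv X Y Z).
Hypothesis Rv_linear3 : forall X Y, linear (Rv X Y).
Hypothesis Rv_skew12 : forall X Y Z, Rv X Y Z = - Rv Y X Z.
Hypothesis Rm_skew34 : forall X Y Z W, Rm X Y Z W = - Rm X Y W Z.
Hypothesis Rv_bianchi : forall X Y Z, Rv X Y Z + Rv Y Z X + Rv Z X Y = 0.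

Let S X Y := tr (fun u v => Rm u X Y v).
Let So X := graise h (S X).
Let kappa := tr S.

Let gD_l u v w : g (u + v) w = g u w + g v w.
Proof. exact: (is_scalarD (gform_linear_l h w)). Qed.

Let gN_l u w : g (- u) w = - g u w.
Proof. exact: (is_scalarN (gform_linear_l h w)). Qed.

Let gZ_l (a : R) u w : g (a *: u) w = a * g u w.
Proof. exact: (is_scalarZ (gform_linear_l h w)). Qed.

Let gE := (gD_l, gN_l, gZ_l).

Lemma Rm_skew12 X Y Z W : Rm X Y Z W = - Rm Y X Z W.
Proof. by rewrite Rv_skew12 gN_l. Qed.

(** The classical linear combination of the four Bianchi identities for cyclic shifts of (X, Y, Z,
    W), with skewness in each pair of arguments. *)
Lemma Rm_pair X Y Z W : Rm X Y Z W = Rm Z W X Y.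
Proof.
have bia A B C D : Rm A B C D + Rm B C A D + Rm C A B D = 0.
  by rewrite -!gD_l Rv_bianchi /gform !mul0mx mxE.
have := bia X Y Z W; have := bia Y Z W X; have := bia Z W X Y; have := bia W X Y Z.
have := Rm_skew34 Y Z W X; have := Rm_skew34 Z W Y X; have := Rm_skew34 W X Z Y.
have := Rm_skew34 X Z W Y; have := Rm_skew12 X Z Y W; have := Rm_skew34 X Y W Z.
have := Rm_skew34 Y W X Z; have := Rm_skew12 Y W Z X; lra.
Qed.

Lemma Rv_linear2 X Z : linear (fun Y => Rv X Y Z).
Proof.
move=> a u v /=; rewrite Rv_skew12 Rv_linear1 opprD -scalerN.
by rewrite -!Rv_skew12.
Qed.

Lemma ric_sym X Y : S X Y = S Y X.
Proof.
rewrite /S -gtrace_sym//; apply: eq_gtrace => u v.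
by rewrite Rm_pair Rm_skew12 Rm_skew34 opprK.
Qed.

Lemma ric_linear_r X : scalar (S X).
Proof.
move=> a u v; rewrite /S -gtraceZ -gtraceD; apply: eq_gtrace => x y.
by rewrite Rv_linear3 gD_l gZ_l.
Qed.

Lemma ric_linear_l Y : scalar (fun X => S X Y).
Proof. by move=> a u v; rewrite !(ric_sym _ Y) ric_linear_r. Qed.

Lemma gform_ric_op X Y : g (So X) Y = S X Y.
Proof. by rewrite gform_graise//; exact: ric_linear_r. Qed.

Lemma ric_op_linear : linear So.
Proof.
move=> a u v; apply: (gform_inj symh unith) => w.
by rewrite gD_l gZ_l !gform_ric_op ric_linear_l.
Qed.

Lemma ric_op_adjoint X Y : g (So X) Y = g X (So Y).
Proof. by rewrite gform_ric_op ric_sym -gform_ric_op gform_sym. Qed.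

Lemma ric_op_shift X Y : S (So X) Y = S X (So Y).
Proof. by rewrite -!gform_ric_op ric_op_adjoint. Qed.

Lemma ric_op_swap X Y : S X (So Y) = S Y (So X).
Proof. by rewrite -ric_op_shift ric_sym. Qed.

Let E X Y := tr (fun u v => Rm u X Y (So v)).

Let c : R := (N - 1)^-1.
Hypothesis N1 : N - 1 != 0.
Hypothesis N0 : N != 0.

Let Pv X1 X2 X3 := graise h (fun X4 =>
  Rm X1 X2 X3 X4 - c * (S X2 X3 * g X1 X4 - S X1 X3 * g X2 X4)).

Lemma proj_tensorE X Y Z : Pv X Y Z = Rv X Y Z - c *: wedge_op S X Y Z.
Proof.
have E1 w : g (Rv X Y Z - c *: wedge_op S X Y Z) w =
  Rm X Y Z w - c * (S Y Z * g X w - S X Z * g Y w) by rewrite !gE.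
apply: (gform_inj symh unith) => w; rewrite E1 gform_graise//.
move=> a u v; rewrite -!E1; exact: gform_linear_r.
Qed.

Lemma gform_proj_tensor X Y Z W :
  g (Pv X Y Z) W = Rm X Y Z W - c * (S Y Z * g X W - S X Z * g Y W).
Proof. by rewrite proj_tensorE /wedge_op !gE. Qed.

Let wedge_lin3 X Y : linear (wedge_op S X Y).
Proof.
move=> a u v; rewrite /wedge_op !ric_linear_r !scalerDl !scalerBr !scalerA.
by rewrite opprD addrACA.
Qed.

Let wedge_lin1 Y Z : linear (fun X => wedge_op S X Y Z).
Proof.
move=> a u v; rewrite /wedge_op /= ric_linear_l scalerDr !scalerBr !scalerA scalerDl.
by rewrite opprD addrACA [_ * a]mulrC.
Qed.

Let wedge_lin2 X Z : linear (fun Y => wedge_op S X Y Z).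
Proof.
move=> a u v; rewrite /wedge_op /= ric_linear_l scalerDr !scalerBr !scalerA scalerDl.
by rewrite opprD addrACA [_ * a]mulrC.
Qed.

Let sub_lin (f k : V -> V) :
  linear f -> linear k -> linear (fun x => f x - c *: k x).
Proof.
move=> lf lk a u v /=; rewrite lf lk scalerDr !scalerA scalerBr scalerA.
by rewrite opprD addrACA (mulrC c).
Qed.

Lemma Pv_linear1 Y Z : linear (fun X => Pv X Y Z).
Proof.
move=> a u v; rewrite !proj_tensorE.
exact: (sub_lin (@Rv_linear1 Y Z) (@wedge_lin1 Y Z)).
Qed.

Lemma Pv_linear2 X Z : linear (fun Y => Pv X Y Z).
Proof.
move=> a u v; rewrite !proj_tensorE.
exact: (sub_lin (@Rv_linear2 X Z) (@wedge_lin2 X Z)).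
Qed.

Lemma Pv_linear3 X Y : linear (Pv X Y).
Proof.
move=> a u v; rewrite !proj_tensorE.
exact: (sub_lin (@Rv_linear3 X Y) (@wedge_lin3 X Y)).
Qed.

(** Contracting the middle slots, the curvature part yields [So Z] and X /\_S Y yields kappa Z -
    [So Z]; then 1 + c = c N. The functional [phi] makes the vector-valued contraction a scalar
    trace. *)
Lemma gtrace_proj_tensor (phi : V -> R) Z : scalar phi ->
  tr (fun u v => phi (Pv Z u v)) = c * (N * phi (So Z) - kappa * phi Z).
Proof.
move=> lphi.
pose phi' := graise h phi.
have gphi u : phi u = g u phi' by rewrite gform_sym// gform_graise.
have trR : tr (fun u v => phi (Rv Z u v)) = phi (So Z).
  rewrite gphi gform_ric_op; apply: eq_gtrace => u v.
  by rewrite gphi Rm_skew12 Rm_skew34 opprK.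
rewrite (@eq_gtrace _ _ _ _ (fun u v => phi (Rv Z u v) -
    c * (phi Z * S u v - phi u * g (So Z) v))); last first.
  move=> u v; rewrite proj_tensorE (is_scalarB lphi) (is_scalarZ lphi) /wedge_op.
  rewrite (is_scalarB lphi) !(is_scalarZ lphi) gform_ric_op.
  by rewrite [phi Z * _]mulrC [phi u * _]mulrC.
rewrite gtraceB gtraceZ gtraceB gtraceZ gtrace_gform_r// trR.
rewrite -/kappa /c; field.
exact: N1.
Qed.

(** * Consequences of the condition P.P = L Q(S,P) *)

Variable L : R.
Hypothesis PP : forall X1 X2 X3 X Y,
  act13 (Pv X Y) Pv X1 X2 X3 = L *: Qten13 S Pv X1 X2 X3 X Y.

Let m := L + c.
Let l X Y Z := Rv X Y Z - m *: wedge_op S X Y Z.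

Let linD (f : V -> V) (a b : V) : linear f -> f (a + b) = f a + f b.
Proof. by move=> lf; rewrite -[a in LHS]scale1r lf scale1r. Qed.

Let linZ (f : V -> V) r (a : V) : linear f -> f (r *: a) = r *: f a.
Proof.
move=> lf; have f0 : f 0 = 0.
  have := linD 0 0 lf; rewrite addr0 => /esym/eqP.
  by rewrite -subr_eq0 addrK => /eqP.
by rewrite -[r *: a]addr0 lf f0 addr0.
Qed.

(** As endomorphisms, l(X,Y) = P(X,Y) - L X /\_S Y. The action on a multilinear map is linear in the
    acting endomorphism, so the hypothesis says exactly that l(X,Y) acts on [Pv] by zero. *)
Lemma proj_tensor_derivation X Y X1 X2 X3 :
  l X Y (Pv X1 X2 X3) =
  Pv (l X Y X1) X2 X3 + Pv X1 (l X Y X2) X3 + Pv X1 X2 (l X Y X3).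
Proof.
have lE Z : l X Y Z = Pv X Y Z + (- L) *: wedge_op S X Y Z.
  by rewrite proj_tensorE /l /m scalerDl opprD scaleNr addrA addrAC.
have := PP X1 X2 X3 X Y; rewrite /Qten13 /act13 => H.
rewrite !lE.
rewrite (linD _ _ (@Pv_linear1 X2 X3)) (linZ _ _ (@Pv_linear1 X2 X3)).
rewrite (linD _ _ (@Pv_linear2 X1 X3)) (linZ _ _ (@Pv_linear2 X1 X3)).
rewrite (linD _ _ (@Pv_linear3 X1 X2)) (linZ _ _ (@Pv_linear3 X1 X2)).
rewrite scaleNr; apply/eqP; rewrite subr_eq -(subrK
 (Pv (Pv X Y X1) X2 X3 + Pv X1 (Pv X Y X2) X3 + Pv X1 X2 (Pv X Y X3)) (Pv X Y _)) H.
rewrite scalerBr !scaleNr !scalerDr; apply/eqP/rowP => j; rewrite !mxE; ring.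
Qed.

(* g([X /\_S Y, So] Z, W). *)
Let DF X Y Z W := S Y (So Z) * g X W - S X (So Z) * g Y W
  + S X Z * S Y W - S Y Z * S X W.

(** The curvature part of the bracket that the two middle slots produce in [gtrace_middle_slots]. *)
Let Rt X Y Z W := Rm Z X (So Y) W - Rm Z Y (So X) W
  + Rm Z (So Y) X W - Rm Z (So X) Y W.

Let l_lin X Y : linear (l X Y).
Proof.
move=> a u v; rewrite /l Rv_linear3 wedge_lin3; apply/rowP => j; rewrite !mxE; ring.
Qed.

Let g_l X Y Z W : g (l X Y Z) W = Rm X Y Z W - m * (S Y Z * g X W - S X Z * g Y W).
Proof. by rewrite /l /wedge_op !gE. Qed.

(* The part R(X,Y) of l is skew-adjoint, so its contributions from the two slots
   cancel. *)
Lemma gtrace_middle_slots X Y Z W :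
  tr (fun u v => g (Pv Z (l X Y u) v) W + g (Pv Z u (l X Y v)) W) =
  - m * (g (Pv Z X (So Y)) W - g (Pv Z Y (So X)) W
         + g (Pv Z (So Y) X) W - g (Pv Z (So X) Y) W).
Proof.
pose Q u v := g (Pv Z u v) W.
have Ql v : scalar (fun u => Q u v).
  by move=> a x y; rewrite /Q Pv_linear2 gD_l gZ_l.
have Qr u : scalar (Q u).
  by move=> a x y; rewrite /Q Pv_linear3 gD_l gZ_l.
(* In X /\_S Y applied to u, the factor S(Y, u) = g([So Y], u) is contracted with the remaining slot
   of [Q] and puts [So Y] there. *)
have trl : tr (fun u v => Q (l X Y u) v) =
    tr (fun u v => Q (Rv X Y u) v) - m * (Q X (So Y) - Q Y (So X)).
  rewrite -(gtrace_gform_l symh unith (So Y) (Qr X)).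
  rewrite -(gtrace_gform_l symh unith (So X) (Qr Y)).
  rewrite -gtraceB -gtraceZ -gtraceB; apply: eq_gtrace => u v.
  rewrite /l /wedge_op (is_scalarB (Ql v)) (is_scalarZ (Ql v)).
  rewrite (is_scalarB (Ql v)) !(is_scalarZ (Ql v)).
  by rewrite -!gform_ric_op !(gform_sym symh _ u).
have trr : tr (fun u v => Q u (l X Y v)) =
    tr (fun u v => Q u (Rv X Y v)) - m * (Q (So Y) X - Q (So X) Y).
  rewrite -(gtrace_gform_r symh unith (So Y) (Ql X)).
  rewrite -(gtrace_gform_r symh unith (So X) (Ql Y)).
  rewrite -gtraceB -gtraceZ -gtraceB; apply: eq_gtrace => u v.
  rewrite /l /wedge_op (is_scalarB (Qr u)) (is_scalarZ (Qr u)).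
  rewrite (is_scalarB (Qr u)) !(is_scalarZ (Qr u)).
  by rewrite -!gform_ric_op ![_ * Q u _]mulrC.
have trR : tr (fun u v => Q (Rv X Y u) v) = - tr (fun u v => Q u (Rv X Y v)).
  rewrite (@gtrace_adjoint _ _ _ symh unith Q (Rv X Y) (fun v => - Rv X Y v))//.
    by rewrite -gtraceN; apply: eq_gtrace => u v; rewrite (is_scalarN (Qr u)).
  by move=> u v; rewrite Rm_skew34 (gform_sym symh u) gN_l.
transitivity (tr (fun u v => Q (l X Y u) v) + tr (fun u v => Q u (l X Y v))).
  exact: gtraceD.
rewrite trl trr trR /Q; ring.
Qed.

(** This is [proj_tensor_derivation] traced over the middle slots of [Pv]. The terms with kappa
    cancel between l outside [Pv] and l in its first slot, leaving the commutator of l(X,Y) with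
    [So]; the Ricci terms of the middle slots are -c m [DF], so [DF] is left with the factor m (c N
    - c) = m. *)
Lemma contracted_identity X Y Z W :
  c * N * (Rm X Y (So Z) W - Rm X Y Z (So W)) + m * Rt X Y Z W
  = m * DF X Y Z W.
Proof.
have lphi : scalar (fun x => g (l X Y x) W).
  by move=> a u v; rewrite l_lin gD_l gZ_l.
have : tr (fun u v => g (l X Y (Pv Z u v)) W) =
    tr (fun u v => g (Pv (l X Y Z) u v) W)
    + tr (fun u v => g (Pv Z (l X Y u) v) W + g (Pv Z u (l X Y v)) W).
  rewrite -gtraceD; apply: eq_gtrace => u v.
  by rewrite proj_tensor_derivation !gD_l addrA.
rewrite (gtrace_proj_tensor Z lphi).
rewrite (gtrace_proj_tensor (l X Y Z) (gform_linear_l h W)).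
rewrite gtrace_middle_slots ric_op_adjoint !g_l !gform_proj_tensor.
rewrite -!ric_op_adjoint !gform_ric_op !ric_op_shift.
rewrite (ric_sym Z X) (ric_sym Z Y) (ric_op_swap Y X).
rewrite (ric_op_swap Z Y) (ric_op_swap Z X) => H.
have cN : c * N = 1 + c by rewrite /c; field; exact: N1.
(* The relation c N = 1 + c is supplied already multiplied by its cofactor, since the closing step
   is linear in the monomials. *)
have K : m * DF X Y Z W * (c * N) = m * DF X Y Z W * (1 + c) by rewrite cN.
move: H K; rewrite /Rt /DF; clearbody m c kappa; lra.
Qed.

Lemma gtrace_Rt Y Z : tr (fun X W => Rt X Y Z W) = E Y Z - S Y (So Z).
Proof.
have t1 : tr (fun X W => Rm Z X (So Y) W) = - S Y (So Z).
  rewrite -(ric_op_swap Z Y) -gtraceN; apply: eq_gtrace => X W.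
  by rewrite Rm_skew12.
(* Self-adjointness moves [So] from X to W, while skewness in the last two arguments changes the
   sign: the trace equals its own negative. *)
have t2 : tr (fun X W => Rm Z Y (So X) W) = 0.
  have lin1 W : scalar (fun X => Rm Z Y X W).
    by move=> a u v; rewrite Rv_linear3 gD_l gZ_l.
  have := @gtrace_adjoint _ _ _ symh unith (fun u v => Rm Z Y u v) So So lin1
    (fun u => gform_linear_r symh (Rv Z Y u)) ric_op_adjoint.
  have -> : tr (fun u v => Rm Z Y u (So v)) = - tr (fun u v => Rm Z Y (So u) v).
    rewrite -(gtrace_sym symh (fun u v => Rm Z Y (So u) v)) -gtraceN.
    by apply: eq_gtrace => u v; rewrite Rm_skew34.
  lra.
have t3 : tr (fun X W => Rm Z (So Y) X W) = 0.
  by apply: gtrace_skew => // u v; rewrite Rm_skew34.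
have t4 : tr (fun X W => Rm Z (So X) Y W) = - E Y Z.
  rewrite /E -(gtrace_sym symh (fun u v => Rm u Y Z (So v))) -gtraceN.
  apply: eq_gtrace => X W.
  by rewrite Rm_pair Rm_skew12.
by rewrite /Rt gtraceB gtraceD gtraceB t1 t2 t3 t4; lra.
Qed.

Lemma gtrace_DF Y Z :
  tr (fun X W => DF X Y Z W) = N * S Y (So Z) - kappa * S Y Z.
Proof.
have trX : tr (fun X W => S X (So Z) * g Y W) = S Y (So Z).
  by rewrite gtrace_gform_r//; exact: ric_linear_l.
have trS : tr (fun X W => S X Z * S Y W) = S Y (So Z).
  rewrite -(gtrace_gform_l symh unith (So Z) (ric_linear_r Y)).
  by apply: eq_gtrace => u v; rewrite -ric_op_adjoint gform_ric_op.
rewrite /DF gtraceB gtraceD gtraceB !gtraceZ gtrace_gform// trX trS -/kappa.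
ring.
Qed.

(** The trace of [contracted_identity] over its first and last arguments reads c N (S^2 - E) + m (E
    - S^2) = m (N S^2 - kappa S); multiplication by N - 1 clears [c]. *)
Lemma ric_square_identity X Y :
  (L - 1) * (N - 1) * E X Y =
  - (1 + L * (N - 1)) * kappa * S X Y + (1 + L * (N ^+ 2 - 1)) * S (So X) Y.
Proof.
have trA1 : tr (fun u v => Rm u X (So Y) v) = S X (So Y) by [].
have : tr (fun u v => c * N * (Rm u X (So Y) v - Rm u X Y (So v)) + m * Rt u X Y v)
    = tr (fun u v => m * DF u X Y v).
  by apply: eq_gtrace => u v; exact: contracted_identity.
rewrite gtraceD !gtraceZ gtraceB gtrace_Rt gtrace_DF trA1.
rewrite -/(E X Y) ric_op_shift => H.
have cN1 : c * (N - 1) = 1 by rewrite mulVf.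
move: H; rewrite /m; move: (E X Y) (S X Y) (S X (So Y)) => e s s2 H.
(* The two correction terms are multiples of the traced relation and of c (N - 1) = 1, so both
   vanish. *)
have -> : (L - 1) * (N - 1) * e = - (1 + L * (N - 1)) * kappa * s
    + (1 + L * (N ^+ 2 - 1)) * s2
    + (N - 1) * ((c * N * (s2 - e) + (L + c) * (e - s2))
                 - (L + c) * (N * s2 - kappa * s))
    - (c * (N - 1) - 1) * (- (N - 1) * e + (N - 1) * s2 - N * s2 + kappa * s).
  ring.
by rewrite H cN1 !subrr mul0r mulr0; ring.
Qed.

(** The curvature side of [contracted_identity] is symmetric in Z and W: the commutator by skewness
    of R, [Rt] by pair symmetry. Once m is cancelled [DF] is symmetric too, and its skew part is the
    difference of the two Kulkarni-Nomizu products. *)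
Lemma KN_ric_ric X Y Z W : m != 0 ->
  KN S S X Y Z W = KN g (fun u v => S (So u) v) X Y Z W.
Proof.
move=> m0.
have sym : m * DF X Y Z W = m * DF X Y W Z.
  rewrite -!contracted_identity.
  have -> : Rm X Y (So Z) W - Rm X Y Z (So W) = Rm X Y (So W) Z - Rm X Y W (So Z).
    by rewrite (Rm_skew34 X Y (So Z)) (Rm_skew34 X Y Z); ring.
  suff -> : Rt X Y Z W = Rt X Y W Z by [].
  have swap u v : Rm Z u (So v) W = Rm W (So v) u Z.
    by rewrite Rm_pair Rm_skew12 Rm_skew34 opprK.
  have swap' u v : Rm Z (So v) u W = Rm W u (So v) Z.
    by rewrite Rm_pair Rm_skew12 Rm_skew34 opprK.
  by rewrite /Rt !swap !swap'; ring.
have := mulfI m0 sym; rewrite /DF /KN !ric_op_shift; lra.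
Qed.

Lemma ric_square_quadratic : m != 0 ->
  (forall X Y, N ^+ 2 * S (So X) Y - 2 * N * kappa * S X Y + kappa ^+ 2 * g X Y = 0)
  /\ \tr (lin1_mx (So \o So)) = kappa ^+ 2 / N.
Proof.
move=> m0.
pose k2 := tr (fun u v => S (So u) v).
(* The trace of S /\ S = g /\ S^2 over the outer arguments: 2 kappa S - 2 S^2 = N S^2 + k2 g - 2
   S^2. *)
have tr1 X Y : N * S (So X) Y - 2 * kappa * S X Y + k2 * g X Y = 0.
  have trS : tr (fun u v => S u Y * S X v) = S (So X) Y.
    rewrite ric_op_shift -(gtrace_gform_l symh unith (So Y) (ric_linear_r X)).
    by apply: eq_gtrace => u v; rewrite -ric_op_adjoint gform_ric_op.
  have trS' : tr (fun u v => S X v * S u Y) = S (So X) Y.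
    by rewrite -trS; apply: eq_gtrace => u v; rewrite mulrC.
  have : tr (fun u v => KN S S u X Y v) =
      tr (fun u v => KN g (fun a b => S (So a) b) u X Y v).
    by apply: eq_gtrace => u v; exact: KN_ric_ric.
  have lS2 : scalar (fun u => S (So u) Y).
    by move=> a u v; rewrite ric_op_linear ric_linear_l.
  have gX : tr (fun u v => g X v * S (So u) Y) = S (So X) Y.
    rewrite -(gtrace_gform_r symh unith X lS2).
    by apply: eq_gtrace => u v; rewrite mulrC.
  have gY : tr (fun u v => g u Y * S (So X) v) = S (So X) Y.
    by rewrite gtrace_gform_l//; exact: ric_linear_r.
  have kS : tr (fun u v => S u v * S X Y) = kappa * S X Y.
    by rewrite mulrC -gtraceZ; apply: eq_gtrace => u v; rewrite mulrC.
  have kg : tr (fun u v => g u v * S (So X) Y) = N * S (So X) Y.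
    rewrite -(gtrace_gform symh unith) mulrC -gtraceZ.
    by apply: eq_gtrace => u v; rewrite mulrC.
  rewrite /KN !gtraceB !gtraceD !gtraceZ kS kg gX gY trS trS' -/kappa -/k2; lra.
(* A second trace gives 2 N k2 = 2 kappa^2. *)
have k2E : k2 = kappa ^+ 2 / N.
  have : tr (fun X Y => N * S (So X) Y - 2 * kappa * S X Y + k2 * g X Y) = 0.
    transitivity (tr (fun _ _ => 0 * 0)); last by rewrite gtraceZ mul0r.
    by apply: eq_gtrace => u v; rewrite mulr0; exact: tr1.
  rewrite gtraceD gtraceB !gtraceZ gtrace_gform// -/k2 -/kappa => H.
  apply: (mulfI N0); rewrite [RHS]mulrC divfK//; lra.
split.
  move=> X Y; have := tr1 X Y; rewrite k2E => H.
  by rewrite -(mulr0 N) -H; field; exact: N0.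
rewrite -k2E -(gtrace_endo symh unith).
  by apply: eq_gtrace => u v; rewrite gform_ric_op.
by move=> a u v; rewrite /= !ric_op_linear.
Qed.

(** With [Rt] = 0, c N [R(X,Y), So] = m [DF]. Since [P(X,Y), So] differs from [R(X,Y), So] by -c
    [DF], the coefficient becomes m - c (c N) = L - c^2. *)
Lemma proj_dot_ric_op :
  (forall X1 X2 X Y, Rm Y X1 X2 (So X) + Rm Y X2 X1 (So X)
     - Rm X X1 X2 (So Y) - Rm X X2 X1 (So Y) = 0) ->
  forall X1 X Y,
    (N / (N - 1)) *: act11 (Pv X Y) So X1 =
    (L - ((N - 1) ^+ 2)^-1) *: Qten11 S So X1 X Y.
Proof.
move=> Rsym Z X Y; apply: (gform_inj symh unith) => W.
(* Pair symmetry and skewness turn the assumed expression at (Z, W, X, Y) into the negative of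
   [Rt X Y Z W]. *)
have Rt0 : Rt X Y Z W = 0.
  have := Rsym Z W X Y; rewrite /Rt.
  rewrite (Rm_pair Z (So Y)) (Rm_pair Z (So X)).
  rewrite (Rm_skew12 Z X) (Rm_skew12 Z Y).
  rewrite (Rm_skew34 X Z (So Y)) (Rm_skew34 Y Z (So X)).
  rewrite (Rm_skew34 X W Z) (Rm_skew34 Y W Z).
  rewrite (Rm_skew34 X W (So Y)) (Rm_skew34 Y W (So X)).
  lra.
have := contracted_identity X Y Z W; rewrite Rt0 mulr0 addr0 => H.
rewrite !gZ_l /Qten11 /act11 !gD_l !gN_l.
rewrite (ric_op_adjoint (Pv _ _ _)) (ric_op_adjoint (wedge_op _ _ _ _)).
rewrite !gform_proj_tensor /wedge_op !gE.
rewrite -!ric_op_adjoint !gform_ric_op.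
have cE : N / (N - 1) = c * N by rewrite mulrC.
have c2E : ((N - 1) ^+ 2)^-1 = c ^+ 2 by rewrite exprVn.
have cN : c * N = 1 + c by rewrite /c; field; exact: N1.
rewrite cE c2E.
have K : c * DF X Y Z W * (c * N) = c * DF X Y Z W * (1 + c) by rewrite cN.
move: H K; rewrite -ric_op_adjoint gform_ric_op /DF /m; clearbody c kappa; lra.
Qed.

End curvature_algebra.

(** * The theorem at a point of a chart *)

Unset Implicit Arguments.

Theorem theorem4p16 (R : realType) (n : nat) (hn : (3 <= n)%N)
  (M : smooth_manifold R n) (g : semi_riemannian_metric M)
  (L : M -> R) (hL : smooth_function L)
  (hP : forall (i : chart_index M) (p : M), chart_dom i p ->
     forall X1 X2 X3 X Y : 'rV[R]_n,
       Pdot13 (gram g i) (chart_map i p) (proj13 (gram g i) (chart_map i p))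
         X1 X2 X3 X Y =
       L p *: Qten13 (ricci (gram g i) (chart_map i p))
                (proj13 (gram g i) (chart_map i p)) X1 X2 X3 X Y) :
  forall (i : chart_index M) (p : M), chart_dom i p ->
  let G := gram g i in
  let x := chart_map i p in
  let N : R := n%:R in
  let S := ricci G x in
  let S2 := ricci2 G x in
  let kappa := scalar_curv G x in
  [/\ (* (i) *)
      forall X Y : 'rV[R]_n,
        (L p - 1) * (N - 1) * Eten G x X Y =
        - (1 + L p * (N - 1)) * kappa * S X Y
        + (1 + L p * (N ^+ 2 - 1)) * S2 X Y,
      (* (ii) *)
      L p + (N - 1)^-1 <> 0 ->
        (forall X Y : 'rV[R]_n,
           N ^+ 2 * S2 X Y - 2 * N * kappa * S X Y
           + kappa ^+ 2 * gform (G x) X Y = 0) /\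
        scalar_curv2 G x = kappa ^+ 2 / N,
      (* (iii) *)
      L p + (N - 1)^-1 <> 0 ->
        (forall X1 X2 X Y : 'rV[R]_n,
           curv G x Y X1 X2 (ricci_op G x X) + curv G x Y X2 X1 (ricci_op G x X)
           - curv G x X X1 X2 (ricci_op G x Y)
           - curv G x X X2 X1 (ricci_op G x Y) = 0) ->
        forall X1 X Y : 'rV[R]_n,
          (N / (N - 1)) *: Pdot11 G x (ricci_op G x) X1 X Y =
          (L p - ((N - 1) ^+ 2)^-1) *: Qten11 S (ricci_op G x) X1 X Y
    & (* (iv) *)
      L p + (N - 1)^-1 <> 0 ->
        forall X1 X2 X3 X4 : 'rV[R]_n,
          KN S S X1 X2 X3 X4 = KN (gform (G x)) S2 X1 X2 X3 X4].
Proof.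
move=> i p ip G x N S S2 kappa.
have Ux : chart_codom i x by exists p.
have oU : open (chart_codom i) := @chart_codom_open R n M i.
have symh : (G x)^T = G x := gram_sym g Ux.
have unith : G x \in unitmx := gram_nondegenerate g Ux.
(* With [Rv] taken as [curv13 G x], the tensors [S], [So], [Pv] and [E] of the algebraic section
   unfold to [ricci], [ricci_op], [proj13] and [Eten], so its results apply by conversion. *)
have lin1 := @curv13_linear1 R n G x.
have lin3 := @curv13_linear3 R n G x.
have skew12 := @curv13_skew12 R n G x.
have skew34 := curv_skew34 oU (gram_smooth g i) (@gram_sym R n M g i)
  (@gram_nondegenerate R n M g i) Ux.
have bianchi := curv13_bianchi oU (@gram_sym R n M g i) Ux.
have N1 : N - 1 != 0.
  by rewrite subr_eq0 pnatr_eq1; case: (n) hn => [|[|]].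
have N0 : N != 0 by rewrite pnatr_eq0; case: (n) hn.
have S2E X Y : S2 X Y = S (ricci_op G x X) Y.
  exact: (@gform_ric_op R n (G x) symh unith (curv13 G x) lin3 (ricci_op G x X) Y).
have PP := hP i p ip.
split.
- move=> X Y; rewrite S2E.
  exact: (@ric_square_identity R n (G x) symh unith (curv13 G x)
    lin1 lin3 skew12 skew34 bianchi N1 (L p) PP X Y).
- move=> /eqP m0.
  have [quad tr2] := @ric_square_quadratic R n (G x) symh unith (curv13 G x)
    lin1 lin3 skew12 skew34 bianchi N1 N0 (L p) PP m0.
  by split=> [X Y|]; [rewrite S2E; exact: quad | exact: tr2].
- move=> _ Rsym.
  exact: (@proj_dot_ric_op R n (G x) symh unith (curv13 G x)
    lin1 lin3 skew12 skew34 bianchi N1 (L p) PP Rsym).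
- move=> /eqP m0 X1 X2 X3 X4.
  have := @KN_ric_ric R n (G x) symh unith (curv13 G x)
    lin1 lin3 skew12 skew34 bianchi N1 (L p) PP X1 X2 X3 X4 m0.
  by rewrite /KN !S2E.
Qed.
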